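(* Let $\lambda$ be a partition of a positive integer $n$, let $(i_1,i'_1),\dots,(i_s,i'_s)$ be the removable cells of its Young diagram, let $\lambda\!\downarrow_j$ be the partition obtained from $\lambda$ by removing the cell $(i_j,i'_j)$, let $\lambda'$ be the dual partition, and let $\alpha_k$ be the number of parts of $\lambda$ equal to $k$. Then $$R_\lambda=\sum_{j=1}^{s}q^{\lambda'_{i'_j+1}}\left(1+q+\dots+q^{\alpha_{i'_j-1}}\right)R_{\lambda\downarrow_j}=\sum_{j=1}^{s}\frac{q^{\lambda'_{i'_j+1}}\left(1-q^{\alpha_{i'_j-1}+1}\right)}{1-q}\,R_{\lambda\downarrow_j},$$ where for $j=1$ one has $i'_1=N'$ and $\lambda'_{i'_1+1}=\lambda'_{N'+1}=0$, and where, if $i'_j=1$, the sum in parentheses in the first formula is $1$ (equivalently, $\alpha_0=0$).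
   Context: A partition of a positive integer $n$ is a sequence $\lambda=(\lambda_1,\dots,\lambda_N)$ of integers with $\lambda_1\ge\dots\ge\lambda_N>0$ and $\lambda_1+\dots+\lambda_N=n$. The dual partition is $\lambda'=(\lambda'_1,\dots,\lambda'_{N'})$ with $\lambda'_j=\#\{i\mid\lambda_i\ge j\}$ and $N'=\lambda_1$; put $\lambda'_{N'+1}=0$. For $k\ge1$, $\alpha_k=\#\{i\mid\lambda_i=k\}$ (possibly $0$). The Young diagram of $\lambda$ has rows of lengths $\lambda_1,\dots,\lambda_N$ from top to bottom; a cell has coordinates $(i,i')$, where $i$ is its row number and $i'$ its column number. A cell is removable if after deleting it the diagram is still a Young diagram. The removable cells $(i_1,i'_1),\dots,(i_s,i'_s)$ are numbered so that $i_1<i_2<\dots<i_s=N$ and $N'=i'_1>i'_2>\dots>i'_s$. For $1\le j\le s$, $\lambda\!\downarrow_j$ is the partition of $n-1$ whose Young diagram is obtained by deleting $(i_j,i'_j)$. (When $n=1$ this is the empty partition, for which $R_\emptyset=1$ by convention.) A strictly upper triangular matrix has Jordan type $\lambda$ if the sizes of its (nilpotent) Jordan blocks, listed in non-increasing order, are $\lambda_1,\dots,\lambda_N$. For a prime power $q$, $P_\lambda(q)$ denotes the number of strictly upper triangular $n\times n$ matrices over the finite field $\mathbb{F}_q$ of Jordan type $\lambda$. It is known that $P_\lambda(q)$ is given by a (nonzero) polynomial in $q$ with integer coefficients, also denoted $P_\lambda$. With $Q=q-1$, write $P_\lambda(q)=q^{d(\lambda)}Q^{e(\lambda)}R_\lambda(q)$,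 where $R_\lambda$ is a polynomial with $R_\lambda(0)\ne0$ and $R_\lambda(1)\ne0$; this determines the non-negative integers $d(\lambda)$, $e(\lambda)$ and the polynomial $R_\lambda$ uniquely. *)

(* Defs.v *)
From HB Require Import structures.
From mathcomp Require Import all_boot all_order all_algebra.
From mathcomp Require Import boolp classical_sets.

Set Implicit Arguments.
Unset Strict Implicit.
Unset Printing Implicit Defensive.

Import Order.TTheory GRing.Theory Num.Theory.
Local Open Scope ring_scope.

(* Partitions are sequences of parts; the empty partition is [::]. *)
Definition is_partition (lam : seq nat) : bool :=
  sorted geq lam && all (fun k => 0 < k)%N lam.

Definition is_partition_of (n : nat) (lam : seq nat) : bool :=
  is_partition lam && (sumn lam == n).

(* dual_part lam j is lambda'_j for j >= 1; it is 0 for j > lambda_1. *)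
Definition dual_part (lam : seq nat) (j : nat) : nat :=
  count (fun k => j <= k)%N lam.

(* mult lam k is alpha_k; it is 0 at k = 0, since parts are positive. *)
Definition mult (lam : seq nat) (k : nat) : nat := count_mem k lam.

(* Cells (row, column) are numbered from 1, and listed row by row. *)
Definition young_diagram (lam : seq nat) : seq (nat * nat) :=
  [seq (i.+1, j.+1) | i <- iota 0 (size lam), j <- iota 0 (nth 0 lam i)]%N.

Definition row_lengths (D : seq (nat * nat)) : seq nat :=
  [seq count (fun c => c.1 == i) D | i <- iota 1 (\max_(c <- D) c.1)].

(* A Young diagram determines its partition, whose parts are its row lengths. *)
Definition is_young_diagram (D : seq (nat * nat)) : bool :=
  is_partition (row_lengths D) && perm_eq D (young_diagram (row_lengths D)).

(* A diagram has at most one removable cell per row, so the order of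
   young_diagram lists the removable cells by strictly increasing row. *)
Definition removable_cells (lam : seq nat) : seq (nat * nat) :=
  [seq c <- young_diagram lam | is_young_diagram (rem c (young_diagram lam))].

Definition remove_cell (lam : seq nat) (c : nat * nat) : seq nat :=
  row_lengths (rem c (young_diagram lam)).

Definition jordan_block (F : fieldType) (k : nat) : 'M[F]_k :=
  \matrix_(i < k, j < k) (i.+1 == j :> nat)%:R.

(* The order of the matrices of Jordan type lam, i.e. sumn lam, written as
   the sum that types the block diagonal matrix \mxdiag. *)
Definition weight (lam : seq nat) : nat :=
  (\sum_(i < size lam) nth 0 lam i)%N.

Definition jordan_mx (F : fieldType) (lam : seq nat) : 'M[F]_(weight lam) :=
  \mxdiag_(i < size lam) jordan_block F (nth 0%N lam i).

Definition has_jordan_type (F : finFieldType) (lam : seq nat)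
    (A : 'M[F]_(weight lam)) : bool :=
  [exists V : 'M[F]_(weight lam),
     (V \in unitmx) && (A == V *m jordan_mx F lam *m invmx V)].

Definition strictly_upper (F : fieldType) (n : nat) (A : 'M[F]_n) : bool :=
  [forall i : 'I_n, forall j : 'I_n, (j <= i)%N ==> (A i j == 0)].

Definition num_jordan_type (F : finFieldType) (lam : seq nat) : nat :=
  #|[set A : 'M[F]_(weight lam) | strictly_upper A & has_jordan_type A]|.

(* P_lambda: the only polynomial taking the right value at every prime power
   q (each finite field F has q = #|F|). *)
Definition P_poly (lam : seq nat) : {poly int} :=
  xget 0 [set p : {poly int} | forall F : finFieldType,
    p.[#|F|%:R] = (num_jordan_type F lam)%:R]%classic.

(* R_lambda: the cofactor of P_lambda prime to q and to Q = q - 1. There is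
   one 0 x 0 matrix, so P_poly [::] = 1 and R_poly [::] = 1, which is the
   convention for the empty partition. *)
Definition R_poly (lam : seq nat) : {poly int} :=
  xget 0 [set r : {poly int} | exists d e : nat,
    [/\ P_poly lam = 'X^d * ('X - 1) ^+ e * r, r.[0] != 0 & r.[1] != 0]]%classic.

(* Main.v *)
Require Import Defs.
From mathcomp Require Import boolp classical_sets.
From mathcomp Require Import all_boot all_order all_algebra mxabelem.
From mathcomp Require Import zify ring.

(** Cut a strictly upper triangular matrix M of order n + 1 along its first row
and column: M is determined by the lower right block A, which is strictly upper
triangular of order n, and by the rest v of the first row.  The Jordan type of
M is that of A with one more cell, and the column of that cell depends only on
the position of v in an increasing chain of subspaces attached to A.

The reason is that Jordan types of strictly upper triangular matrices are read
off from ranks of powers: type lambda means that A^k has rank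
sum_i max(lambda_i - k, 0) for every k, so that rank A^k - rank A^(k+1) is the
column length lambda'_(k+1).  One half is the rank of a power of a Jordan block;
the other half needs a Jordan basis, which is built by adding the standard basis
vectors one at a time ([chains_extend], [strictly_upper_jordan]); the resulting
criterion is [has_jordan_typeP].  For the bordered matrix M,
   rank M^(k+1) = rank A^(k+1) + (1 if v A^k is not in the row space of A^(k+1)),
and the v with v A^k in that row space form im A + ker A^k, of dimension
n - mu'_(k+1) when A has type mu.  These spaces increase with k; if v enters at
k = c - 1, the new cell is in column c.  Hence [count_ranks_rec]: over a field
with q elements the number of matrices of type lambda is the sum over the
removable cells, say in column c, of the number for the smaller partition mu
times q^(n - mu'_c) - q^(n - mu'_(c-1)), without the second term when c = 1.

Since lambda'_(c-1) = lambda'_c + alpha_(c-1), that weight is a power of q times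
a power of q - 1 times 1 + q + ... + q^(alpha_(c-1)).  The recursion of the
statement defines polynomials [R_rec], and the powers of q and of q - 1 cancel
uniformly because of two closed formulas,
   e(lambda) = n - lambda'_1,
   d(lambda) = C(n,2) - C(lambda'_1,2) - sum_k lambda'_k lambda'_(k+1),
whose variation under the removal of a cell is exactly what the weight
contributes ([q_defect_remove], [Q_exponent_remove]).  So P_lambda equals
q^d (q-1)^e [R_rec]: both sides agree at infinitely many primes.  Finally
[R_rec] is positive at 0 and at 1, because every removable cell contributes a
non-negative amount and the one in the last column a positive one; hence it is
the cofactor R_lambda. *)

Set Implicit Arguments.
Unset Strict Implicit.
Unset Printing Implicit Defensive.

Import Order.TTheory GRing.Theory Num.Theory.

(** * Column lengths of a partition *)

(** The rank of the k-th power of a nilpotent matrix of Jordan type lam: a Jordan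
block of size m contributes m - k, truncated at 0.  Equivalently, the number of
cells to the right of column k. *)
Definition pow_rank (lam : seq nat) (k : nat) : nat := \sum_(m <- lam) (m - k).

Lemma pow_rank0 lam : pow_rank lam 0 = sumn lam.
Proof. by rewrite /pow_rank sumnE; apply: eq_bigr => m _; rewrite subn0. Qed.

Lemma pow_rankS lam k :
  pow_rank lam k = pow_rank lam k.+1 + dual_part lam k.+1.
Proof.
rewrite /pow_rank /dual_part -sum1_count [X in _ = _ + X]big_mkcond -big_split.
by apply: eq_bigr => m _ /=; case: ifP; lia.
Qed.

Lemma pow_rank_eq0 lam k : sumn lam <= k -> pow_rank lam k = 0.
Proof.
rewrite /pow_rank; elim: lam => [|m lam IH] /=; first by rewrite big_nil.
by rewrite big_cons => h; rewrite IH; lia.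
Qed.

Lemma dual_part_gt_sumn lam j : sumn lam < j -> dual_part lam j = 0.
Proof.
case: j => // j h; have := pow_rankS lam j.
by rewrite !pow_rank_eq0; lia.
Qed.

Lemma is_partition_cons m s :
  is_partition (m :: s) = [&& 0 < m, all (fun k => k <= m) s & is_partition s].
Proof.
rewrite /is_partition /= path_sortedE; last by move=> a b c; rewrite /geq /=; lia.
by apply/andP/and3P => [[/andP[? ?] /andP[? ?]]|[? ? /andP[? ?]]];
  split=> //; apply/andP.
Qed.

Lemma leq_dual_part lam j j' : j <= j' -> dual_part lam j' <= dual_part lam j.
Proof. by move=> h; apply: sub_count => m /=; apply: leq_trans. Qed.

Lemma ltn_dual_part lam i j : is_partition lam -> 0 < j ->
  (i < dual_part lam j) = (j <= nth 0 lam i).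
Proof.
move=> + j0; elim: lam i => [|m s IH] i; first by rewrite nth_nil; case: j j0.
rewrite is_partition_cons => /and3P[m0 /allP sm ps]; rewrite /dual_part /=.
rewrite -/(dual_part s j); case: (leqP j m) => jm.
  by case: i => [|i] /=; rewrite add1n ?jm // ltnS IH.
have d0 : dual_part s j = 0.
  apply/eqP; rewrite -leqn0 leqNgt -has_count -all_predC; apply/allP => x /sm /= xm.
  by rewrite -ltnNge (leq_ltn_trans xm).
rewrite d0 addn0 ltn0; case: i => [|i] /=; first by lia.
case: (ltnP i (size s)) => si; last by rewrite nth_default //; lia.
by rewrite leqNgt (leq_ltn_trans (sm _ (mem_nth 0 si))).
Qed.

Lemma mult_dual_part lam k : mult lam k + dual_part lam k.+1 = dual_part lam k.
Proof.
rewrite /mult /dual_part -!sum1_count ![\sum_(_ <- _ | _) _]big_mkcond -big_split /=.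
by rewrite [RHS]big_mkcond; apply: eq_bigr => i _ /=; case: (ltngtP k i).
Qed.

Lemma mult0_partition lam : is_partition lam -> mult lam 0 = 0.
Proof. by move=> /andP[_ /allP pl]; apply/count_memPn; apply/negP => /pl. Qed.

Lemma partition_eq lam mu : is_partition lam -> is_partition mu ->
  (forall j, dual_part lam j.+1 = dual_part mu j.+1) -> lam = mu.
Proof.
move=> /andP[sl pl] /andP[sm pm] h.
apply: (sorted_eq _ _ sl sm); first by move=> a b c; rewrite /geq /=; lia.
  by move=> a b /= ab; apply/eqP; rewrite eqn_leq andbC.
apply/allP => k _ /=; rewrite -!/(mult _ k); apply/eqP; case: k => [|k].
  by rewrite !mult0_partition // /is_partition ?sl ?sm.
by have := mult_dual_part lam k.+1; rewrite !h -(mult_dual_part mu k.+1) => /addIn.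
Qed.

Lemma pow_rank_inj lam mu : is_partition lam -> is_partition mu ->
  (forall k, pow_rank lam k = pow_rank mu k) -> lam = mu.
Proof.
move=> pl pm h; apply: partition_eq => // j.
by have := pow_rankS lam j; rewrite !h (pow_rankS mu) => /addnI.
Qed.

Lemma weightE lam : weight lam = sumn lam.
Proof. by rewrite /weight sumnE (big_nth 0) big_mkord. Qed.

(** * Removable cells *)

Lemma count_young (a : pred (nat * nat)) lam : count a (young_diagram lam) =
  \sum_(i < size lam) \sum_(j < nth 0 lam i) a (i.+1, j.+1).
Proof.
rewrite /young_diagram count_flatten sumnE !big_map -(big_mkord xpredT
  (fun i => \sum_(j < nth 0 lam i) a (i.+1, j.+1))).
rewrite /index_iota subn0; apply: eq_bigr => i _.
rewrite count_map -sum1_count big_mkcond -(big_mkord xpredT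
  (fun j => a (i.+1, j.+1) : nat)) /index_iota subn0.
by apply: eq_bigr => j _ /=; case: (a _).
Qed.

Lemma size_young lam : size (young_diagram lam) = sumn lam.
Proof.
rewrite -[LHS]count_predT count_young sumnE (big_nth 0) big_mkord.
by apply: eq_bigr => i _; rewrite sum1_card card_ord.
Qed.

Lemma count_row_young lam i :
  count (fun c => c.1 == i.+1) (young_diagram lam) = nth 0 lam i.
Proof.
rewrite count_young; case: (ltnP i (size lam)) => si.
  rewrite (bigD1 (Ordinal si)) //= eqxx sum1_card card_ord big1 ?addn0 // => k ki.
  by apply: big1 => j _; rewrite eqSS; move: ki; rewrite -val_eqE /= => /negPf->.
rewrite nth_default // big1 // => k _; apply: big1 => j _; rewrite eqSS.
by have := ltn_ord k; case: eqP; lia.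
Qed.

Lemma count_col_young lam j :
  count (fun c => c.2 == j.+1) (young_diagram lam) = dual_part lam j.+1.
Proof.
rewrite count_young /dual_part -sum1_count [RHS]big_mkcond.
rewrite [RHS](big_nth 0) [RHS]big_mkord.
apply: eq_bigr => i _ /=; case: ifP => [si|/negbT si].
  rewrite (bigD1 (Ordinal si)) //= eqxx big1 // => k ki.
  by rewrite eqSS; move: ki; rewrite -val_eqE /= => /negPf->.
apply: big1 => k _; rewrite eqSS.
by have := ltn_ord k; case: eqP; lia.
Qed.

Lemma uniq_young lam : uniq (young_diagram lam).
Proof.
apply: allpairs_uniq_dep; first exact: iota_uniq.
  by move=> i _; apply: iota_uniq.
by move=> [a b] [c d] _ _ /= [-> ->].
Qed.

Lemma mem_young lam a b : is_partition lam ->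
  ((a, b) \in young_diagram lam) = [&& 0 < a, 0 < b & a <= dual_part lam b].
Proof.
move=> pl; apply/allpairsPdep/and3P => [[i [j []]]|[]].
  by rewrite !mem_iota !add0n /= => si sj [-> ->]; rewrite ltn_dual_part.
case: a b => [//|a] [//|b] _ _; rewrite ltn_dual_part // => h.
exists a, b; rewrite !mem_iota !add0n; split=> //=.
by rewrite ltnNge; apply/negP => sa; move: h; rewrite nth_default.
Qed.

(** As the parts are positive, the largest row number is the number of rows. *)
Lemma row_lengths_young lam : is_partition lam ->
  row_lengths (young_diagram lam) = lam.
Proof.
move=> pl; rewrite /row_lengths.
have -> : \max_(c <- young_diagram lam) c.1 = size lam.
  apply/eqP; rewrite eqn_leq; apply/andP; split.
    apply/bigmax_leqP_seq => -[a b] + _; rewrite mem_young //= => /and3P[_ _ h].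
    by apply: leq_trans h (count_size _ _).
  case: (posnP (size lam)) => [-> //|s0].
  have h : (size lam, 1) \in young_diagram lam.
    rewrite mem_young // s0 /= /dual_part; case/andP: pl => _.
    by rewrite all_count => /eqP->.
  by rewrite (bigD1_seq _ h (uniq_young _)) /= leq_maxl.
apply: (@eq_from_nth _ 0); rewrite size_map size_iota // => i si.
by rewrite (nth_map 0) ?size_iota // nth_iota // add1n count_row_young.
Qed.

Lemma perm_row_lengths D E : perm_eq D E -> row_lengths D = row_lengths E.
Proof.
move=> DE; rewrite /row_lengths (perm_big _ DE) /=.
by apply: eq_map => i; apply/permP.
Qed.

(** A decreasing predicate holds on an initial segment, whose length is the count. *)
Lemma leq_count_iota (p : pred nat) M :
  (forall a b, 0 < a <= b -> p b -> p a) ->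
  forall j, 0 < j <= M -> (j <= count p (iota 1 M)) = p j.
Proof.
move=> pdown; elim: M => [|M IH] j; first by case: j.
rewrite -[X in iota _ X]addn1 iotaD count_cat /= addn0 => /andP[j0 jM].
case: (boolP (p (1 + M))) => pM.
  have /eqP-> : count p (iota 1 M) == M.
    rewrite -{2}(size_iota 1 M) -all_count; apply/allP => k.
    by rewrite mem_iota => kM; apply: pdown pM; lia.
  by rewrite addn1 jM (pdown _ _ _ pM) //; lia.
rewrite addn0; case: (ltnP M j) => jM'; last by rewrite IH // j0.
have -> : j = 1 + M by lia.
have := count_size p (iota 1 M); rewrite size_iota (negPf pM).
by move=> h; apply/negbTE; lia.
Qed.

(** The partition is the conjugate: its row i is the number of columns longer
than i.  The bound M makes those counts finite sums over an explicit range. *)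
Lemma partition_of_columns (d : nat -> nat) M :
  (forall a b, 0 < a <= b -> d b <= d a) -> (forall b, M < b -> d b = 0) ->
  exists2 mu, is_partition mu & forall b, 0 < b -> dual_part mu b = d b.
Proof.
move=> dmon d0.
have cE i j : 0 < j ->
    (j <= count (fun b => i < d b) (iota 1 M)) = (i < d j).
  move=> j0; case: (leqP j M) => jM.
    rewrite leq_count_iota ?j0 // => a b /dmon h; lia.
  rewrite d0 // ltn0; have := count_size (fun b => i < d b) (iota 1 M).
  by rewrite size_iota => h; apply/negbTE; lia.
pose mu := [seq count (fun b => i < d b) (iota 1 M) | i <- iota 0 (d 1)].
have nthE i : i < d 1 -> nth 0 mu i = count (fun b => i < d b) (iota 1 M).
  by move=> id; rewrite (nth_map 0) ?size_iota // nth_iota.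
have pmu : is_partition mu.
  apply/andP; split.
    apply/(sortedP 0) => i; rewrite size_map size_iota => id.
    rewrite !nthE //; last by lia.
    by rewrite /geq /=; apply: sub_count => b /=; lia.
  by apply/allP => m /mapP[i]; rewrite mem_iota add0n => /= id ->; rewrite cE.
exists mu => // b b0.
have ltE i : (i < dual_part mu b) = (i < d b).
  rewrite ltn_dual_part //; case: (ltnP i (d 1)) => id; first by rewrite nthE // cE.
  rewrite nth_default ?size_map ?size_iota //.
  by have := dmon 1 b b0; lia.
by have := ltE (d b); have := ltE (dual_part mu b); lia.
Qed.

Lemma removableP lam c : c \in removable_cells lam ->
  is_partition (remove_cell lam c) /\
  perm_eq (young_diagram lam) (c :: young_diagram (remove_cell lam c)).
Proof.
rewrite mem_filter /is_young_diagram -/(remove_cell lam c).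
case/andP=> /andP[pm pe] /perm_to_rem h; split=> //.
by apply: perm_trans h _; rewrite perm_cons.
Qed.

Lemma dual_part_remove lam c j : c \in removable_cells lam ->
  dual_part lam j.+1 = dual_part (remove_cell lam c) j.+1 + (c.2 == j.+1).
Proof.
move/removableP=> [_ /permP/(_ (fun c => c.2 == j.+1))] /=.
by rewrite !count_col_young addnC.
Qed.

Lemma sumn_remove lam c : c \in removable_cells lam ->
  sumn lam = (sumn (remove_cell lam c)).+1.
Proof. by move/removableP=> [_ /perm_size]; rewrite /= !size_young. Qed.

Lemma removable_col_gt0 lam c : is_partition lam ->
  c \in removable_cells lam -> 0 < c.2.
Proof.
move=> pl; rewrite mem_filter => /andP[_]; case: c => a b.
by rewrite mem_young // => /and3P[].
Qed.

(** The column of a removed cell determines the column lengths that remain, hence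
the remaining partition, hence the cell that is missing from it. *)
Lemma removable_col_inj lam c c' :
  c \in removable_cells lam -> c' \in removable_cells lam ->
  c.2 = c'.2 -> c = c'.
Proof.
move=> rc rc' e; have [pm pe] := removableP rc; have [pm' pe'] := removableP rc'.
have em : remove_cell lam c = remove_cell lam c'.
  apply: partition_eq => // j; have := dual_part_remove j rc.
  by rewrite (dual_part_remove j rc') e => /addIn.
have : perm_eq (c :: young_diagram (remove_cell lam c))
               (c' :: young_diagram (remove_cell lam c)).
  by rewrite -(permPl pe) em.
move/permP/(_ (pred1 c)); rewrite /= eqxx => /addIn.
by case: eqP.
Qed.

(** A column that is strictly longer than the next one can be shortened by one
and the lengths stay non-increasing, so they are those of a partition, whose
diagram is the original one without the cell at the bottom of that column. *)
Lemma removable_col_exists lam j : is_partition lam -> 0 < j ->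
  dual_part lam j.+1 < dual_part lam j ->
  exists2 c, c \in removable_cells lam & c.2 = j.
Proof.
move=> pl j0 hj; pose d b := dual_part lam b - (b == j).
have [|b bM|mu pm muE] := @partition_of_columns d (sumn lam).
- move=> a b /andP[a0 ab]; have := leq_dual_part lam ab; rewrite /d.
  case: (ltngtP a b) ab => // [ab|->] _ //.
  case: (eqVneq a j) => [aj|]; last by lia.
  have := leq_dual_part lam ab; rewrite aj in ab *; lia.
- by rewrite /d dual_part_gt_sumn.
pose c := (dual_part lam j, j).
have cl : c \in young_diagram lam by rewrite mem_young // j0 /=; lia.
have pe : perm_eq (rem c (young_diagram lam)) (young_diagram mu).
  apply: uniq_perm; rewrite ?rem_uniq ?uniq_young // => -[a b].
  rewrite mem_rem_uniq ?uniq_young // inE /= !mem_young //.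
  case: (posnP b) => [->|b0]; first by rewrite !andbF.
  rewrite muE // /d /c xpair_eqE.
  by case: (eqVneq b j) => [->|] /=; rewrite ?andbT ?andbF ?subn0 //; lia.
exists c => //; rewrite mem_filter cl andbT /is_young_diagram.
by rewrite (perm_row_lengths pe) row_lengths_young // pm.
Qed.

Lemma uniq_removable lam : uniq (removable_cells lam).
Proof. by rewrite filter_uniq ?uniq_young. Qed.

Lemma pow_rank_remove lam c k : c \in removable_cells lam ->
  is_partition lam -> pow_rank lam k = pow_rank (remove_cell lam c) k + (k < c.2).
Proof.
move=> rc pl; elim: k => [|k IH].
  by rewrite !pow_rank0 (sumn_remove rc) (removable_col_gt0 _ rc) ?addn1.
move: IH; rewrite !(pow_rankS _ k) (dual_part_remove _ rc).
by case: (ltngtP k.+1 c.2); lia.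
Qed.

(** * The exponents of q and of q - 1 *)

(** The last column is followed by an empty one, so it always contains a removable
cell.  Its term in the recursion carries no factor q, and it makes inductions
along removals possible. *)
Lemma removable_last_col lam : is_partition lam -> 0 < sumn lam ->
  exists2 c, c \in removable_cells lam & dual_part lam c.2.+1 = 0.
Proof.
case: lam => [//|m s] pl _.
have m0 : 0 < m by move: pl; rewrite is_partition_cons => /and3P[].
have d1 : 0 < dual_part (m :: s) m by rewrite ltn_dual_part //= leqnn.
have d0 : dual_part (m :: s) m.+1 = 0.
  by apply/eqP; rewrite -leqn0 leqNgt ltn_dual_part //= ltnn.
have [c rc cm] := removable_col_exists pl m0 (leq_ltn_trans (eq_leq d0) d1).
by exists c; rewrite ?cm.
Qed.

Lemma dual_part_sum3 lam j :
  dual_part lam j.+1 + dual_part lam j.+2 + dual_part lam j.+3 <= sumn lam.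
Proof.
have h : pow_rank lam j <= sumn lam.
  rewrite -pow_rank0; apply: leq_sum => m _; lia.
have := pow_rankS lam j; have := pow_rankS lam j.+1; have := pow_rankS lam j.+2.
lia.
Qed.

Lemma dual_part1_2 lam : dual_part lam 1 + dual_part lam 2 <= sumn lam.
Proof.
have := pow_rankS lam 0; have := pow_rankS lam 1; rewrite pow_rank0; lia.
Qed.

Definition adjacent_cols lam M : nat :=
  \sum_(k < M) dual_part lam k.+1 * dual_part lam k.+2.

(** What is missing from the exponent of q in P_lam to reach C(n,2).  The product
terms record a removal through its two neighbouring columns; the binomial
term plays this role for column 0, which does not exist. *)
Definition q_defect lam : nat :=
  'C(dual_part lam 1, 2) + adjacent_cols lam (sumn lam).

Definition q_exponent lam : nat := 'C(sumn lam, 2) - q_defect lam.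
Definition Q_exponent lam : nat := sumn lam - dual_part lam 1.

(** The value for which a removal in column j has weight q^(n - left_col) times a
power of q - 1 times a geometric sum, n cells being left; in the first column it
is the length of that column after the removal. *)
Definition left_col lam j : nat :=
  if 1 < j then dual_part lam j.-1 else (dual_part lam 1).-1.

Section RemoveCell.
Variables (lam : seq nat) (c : nat * nat).
Hypotheses (pl : is_partition lam) (rc : c \in removable_cells lam).
Let mu := remove_cell lam c.

Let c0 : 0 < c.2. Proof. exact: removable_col_gt0 pl rc. Qed.

Lemma dual_part_removable : 0 < dual_part lam c.2.
Proof. by rewrite -(prednK c0) (dual_part_remove _ rc) (prednK c0) eqxx addn1. Qed.

Lemma left_col_bound : left_col lam c.2 + dual_part lam c.2.+1 <= sumn mu.
Proof.
have := sumn_remove rc; have := dual_part_removable; rewrite /left_col -/mu.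
case: c.2 c0 => [//|[|j]] _ /=; first by have := dual_part1_2 lam; lia.
by have := dual_part_sum3 lam j; lia.
Qed.

Lemma adjacent_cols_remove : adjacent_cols lam (sumn lam) =
  adjacent_cols mu (sumn mu) + (1 < c.2) * dual_part lam c.2.-1 + dual_part lam c.2.+1.
Proof.
have cn : c.2 <= sumn lam.
  rewrite leqNgt; apply/negP => h; have := dual_part_removable.
  by rewrite dual_part_gt_sumn.
rewrite (sumn_remove rc) -/mu in cn *.
(* One more column of mu may be summed over, since it is empty. *)
have -> : adjacent_cols mu (sumn mu) = adjacent_cols mu (sumn mu).+1.
  by rewrite [RHS]/adjacent_cols big_ord_recr /= dual_part_gt_sumn // addn0.
rewrite /adjacent_cols; case E : c.2 c0 cn => [//|j] _ jn.
have dE k : dual_part lam k.+1 = dual_part mu k.+1 + (j == k).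
  by rewrite (dual_part_remove k rc) E.
under eq_bigr => k _ do rewrite !dE.
have -> : dual_part lam j.+2 = \sum_(k < (sumn mu).+1) (j == k) * dual_part mu k.+2.
  rewrite (bigD1 (Ordinal jn)) //= eqxx mul1n big1 ?addn0 => [|k].
    by rewrite dE; case: eqP; lia.
  by rewrite -val_eqE /= eq_sym => /negPf->.
have -> : (1 < j.+1) * dual_part lam j =
    \sum_(k < (sumn mu).+1) (j == k.+1) * dual_part mu k.+1.
  case: j E jn dE => [|j] E jn dE; first by rewrite big1.
  rewrite (bigD1 (Ordinal (ltnW jn))) //= eqxx mul1n big1 ?addn0 => [|k].
    by rewrite mul1n dE; case: eqP; lia.
  by rewrite -val_eqE /= eq_sym eqSS => /negPf->.
rewrite -!big_split; apply: eq_bigr => k _ /=.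
by do 2!case: eqP => ? /=; lia.
Qed.

Lemma q_defect_remove :
  q_defect lam = q_defect mu + left_col lam c.2 + dual_part lam c.2.+1.
Proof.
rewrite /q_defect adjacent_cols_remove /left_col (dual_part_remove 0 rc) -/mu.
case: c.2 c0 => [//|[|j]] _ /=; last by rewrite mul1n addn0 !addnA.
by rewrite addn1 binS bin1; lia.
Qed.

Lemma Q_exponent_remove : Q_exponent lam = Q_exponent mu + (1 < c.2).
Proof.
rewrite /Q_exponent (sumn_remove rc) (dual_part_remove 0 rc) -/mu.
have := dual_part1_2 mu; case: c.2 c0 => [//|[|j]] _ /=; lia.
Qed.

End RemoveCell.

(** By induction along removals: C(n,2) grows by n, and the defect by the left and
right neighbours of the removed cell, which together hold at most n cells. *)
Lemma q_defect_bound lam : is_partition lam -> q_defect lam <= 'C(sumn lam, 2).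
Proof.
move: {2}(sumn lam) (erefl (sumn lam)) => n; elim: n lam => [|n IH] lam sl pl.
  have d1 : dual_part lam 1 = 0 by rewrite dual_part_gt_sumn ?sl.
  by rewrite /q_defect d1 sl /adjacent_cols big_ord0.
have [|c rc _] := removable_last_col pl; first by rewrite sl.
have [pm _] := removableP rc.
have sm : sumn (remove_cell lam c) = n by move: (sumn_remove rc); rewrite sl => -[<-].
rewrite (q_defect_remove pl rc) sl binS bin1 -addnA leq_add //.
  by rewrite -sm; apply: IH.
by rewrite -sm; apply: left_col_bound.
Qed.

Lemma q_exponent_remove lam (c : nat * nat) :
  is_partition lam -> c \in removable_cells lam ->
  q_exponent lam + left_col lam c.2 + dual_part lam c.2.+1 =
  q_exponent (remove_cell lam c) + sumn (remove_cell lam c).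
Proof.
move=> pl rc; have [pm _] := removableP rc.
have := q_defect_bound pm; have := q_defect_bound pl.
rewrite /q_exponent (q_defect_remove pl rc) (sumn_remove rc) binS bin1.
have := left_col_bound pl rc; lia.
Qed.

Local Open Scope ring_scope.

(** * Jordan type and ranks of powers *)

Section Jordan.
Variable F : fieldType.

Lemma jordan_block_exp m k :
  jordan_block F m ^+ k = \matrix_(i < m, j < m) ((i + k)%N == j)%:R.
Proof.
elim: k => [|k IH]; first by apply/matrixP => i j; rewrite !mxE addn0.
rewrite exprSr IH; apply/matrixP => i j; rewrite !mxE.
case: (ltnP (i + k)%N m) => ikm.
  rewrite (bigD1 (Ordinal ikm)) //= !mxE eqxx mul1r addnS big1 ?addr0 // => l li.
  rewrite !mxE; case: eqP => [e|]; last by rewrite mul0r.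
  by move: li; rewrite -val_eqE /= e eqxx.
rewrite big1 => [|l _].
  by case: eqP => // e; have := ltn_ord j; lia.
rewrite !mxE; case: eqP => [e|]; last by rewrite mul0r.
by have := ltn_ord l; lia.
Qed.

(** The k-th power N of the block shifts coordinates by k, so N N^T is the partial
identity of rank m - k and multiplication by it fixes N; the two products bound
the rank from both sides. *)
Lemma rank_jordan_block_exp m k : \rank (jordan_block F m ^+ k) = (m - k)%N.
Proof.
set N := _ ^+ k.
have NE i j : N i j = ((i + k)%N == j)%:R by rewrite /N jordan_block_exp mxE.
have rE : \rank (pid_mx (m - k) : 'M[F]_m) = (m - k)%N.
  by rewrite rank_pid_mx // leq_subr.
apply/eqP; rewrite -rE eqn_leq; apply/andP; split.
  have -> : N = pid_mx (m - k) *m N.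
    apply/matrixP => i j; rewrite !mxE (bigD1 i) //= big1 => [|l li].
      rewrite !mxE eqxx /= addr0 !NE; case: ltnP => h; rewrite ?mul1r //.
      by rewrite mul0r; case: eqP => // e; have := ltn_ord j; lia.
    by rewrite !mxE; move: li; rewrite -val_eqE eq_sym => /negPf->; rewrite mul0r.
  exact: mxrankM_maxl.
have <- : N *m N^T = pid_mx (m - k).
  apply/matrixP => i j; rewrite !mxE.
  case: (ltnP (i + k)%N m) => ikm.
    rewrite (bigD1 (Ordinal ikm)) //= !mxE !NE eqxx mul1r big1 ?addr0 => [|l li].
      by rewrite eqn_add2r eq_sym; case: ltnP => h; [rewrite andbT | lia].
    rewrite NE; case: eqP => [e|]; last by rewrite mul0r.
    by move: li; rewrite -val_eqE /= e eqxx.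
  rewrite big1 => [|l _]; first by case: ltnP => h; [lia | rewrite andbF].
  rewrite !NE; case: eqP => [e|]; last by rewrite mul0r.
  by have := ltn_ord l; lia.
exact: mxrankM_maxl.
Qed.

Lemma mxdiag_exp p (p_ : 'I_p -> nat) (B : forall i, 'M[F]_(p_ i)) k :
  (\mxdiag_i B i) ^+ k = \mxdiag_i (B i ^+ k).
Proof.
elim: k => [|k IH]; first by rewrite expr0 -[RHS]/(\mxdiag_i 1%:M) mxdiagZ.
rewrite exprSr IH; have -> : \mxdiag_i B i ^+ k.+1 = \mxdiag_i (B i ^+ k *m B i).
  by apply: eq_mxdiag => i; rewrite exprSr.
rewrite -[LHS]/(_ *m _) {2}/mxdiag mul_mxdiag_mxblock; apply: eq_mxblock => i j.
case: eqP => [ij|_]; last by rewrite mulmx0.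
by case: _ / ij; rewrite !conform_mx_id.
Qed.

Lemma rank_jordan_exp lam k : \rank (jordan_mx F lam ^+ k) = pow_rank lam k.
Proof.
rewrite mxdiag_exp rank_mxdiag /pow_rank (big_nth 0%N) big_mkord.
by apply: eq_bigr => i _; rewrite rank_jordan_block_exp.
Qed.

Lemma intertwine_exp m n (J : 'M[F]_m) (W : 'M_(m, n)) (A : 'M_n) k :
  J *m W = W *m A -> J ^+ k *m W = W *m A ^+ k.
Proof.
move=> h; elim: k => [|k IH]; first by rewrite !expr0 -!idmxE mul1mx mulmx1.
by rewrite !exprSr -!mulmxE -mulmxA h mulmxA IH -mulmxA.
Qed.

(** The change of basis W is rectangular because the order of the Jordan matrix is
only propositionally equal to n. *)
Lemma rank_exp_of_jordan lam n (W : 'M[F]_(weight lam, n)) (A : 'M_n) k :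
  jordan_mx F lam *m W = W *m A -> row_free W -> row_full W ->
  \rank (A ^+ k) = pow_rank lam k.
Proof.
move=> h fr fu; rewrite -rank_jordan_exp -(mxrankMfree _ fr).
by rewrite (intertwine_exp _ h) (eqmxMfull _ fu).
Qed.

Section Chains.
Variables (n : nat) (A : 'M[F]_n).
Implicit Types (x y z w : 'rV[F]_n) (B : seq ('rV[F]_n * nat)).

(** A pair (x, m) stands for the Jordan chain x, xA, ..., xA^(m-1), vectors being
rows on which A acts from the right.  Linear independence is never recorded: if
the lengths add up to n and the chains span, they form a basis. *)
Definition chain x m : 'M[F]_n := (\sum_(j < m) <<x *m A ^+ j>>)%MS.
Definition chains B : 'M[F]_n := (\sum_(p <- B) chain p.1 p.2)%MS.
Definition heads B : 'M[F]_n := (\sum_(p <- B) <<p.1>>)%MS.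
Definition terminates B := all (fun p => p.1 *m A ^+ p.2 == 0) B.
Definition total B : nat := sumn (unzip2 B).

Arguments terminates : simpl never.

Lemma chain_subP x m (S : 'M_n) :
  reflect (forall j, (j < m)%N -> (x *m A ^+ j <= S)%MS) (chain x m <= S)%MS.
Proof.
apply: (iffP sumsmx_subP) => h j.
  by move=> jm; rewrite -genmxE (h (Ordinal jm)).
by move=> _; rewrite genmxE h.
Qed.

Lemma chains_cons p B : chains (p :: B) = (chain p.1 p.2 + chains B)%MS.
Proof. by rewrite /chains big_cons. Qed.

Lemma sub_chain x m j : x *m A ^+ m = 0 -> (x *m A ^+ j <= chain x m)%MS.
Proof.
move=> x0; case: (ltnP j m) => jm.
  by have /chain_subP := submx_refl (chain x m); apply.
by rewrite -(subnKC jm) exprD mulmxA x0 mul0mx sub0mx.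
Qed.

Lemma chain_comb x y t b c m mt : x = b *: y + c *: t -> t *m A ^+ mt = 0 ->
  (chain x m <= chain y m + chain t mt)%MS.
Proof.
move=> -> t0; apply/chain_subP => j jm; rewrite mulmxDl -!scalemxAl addmx_sub_adds //.
  apply: scalemx_sub; have /chain_subP := submx_refl (chain y m); exact.
by apply: scalemx_sub; apply: sub_chain.
Qed.

(** Every chain vector but the head is the image of its predecessor. *)
Lemma chains_step B : (chains B <= chains B *m A + heads B)%MS.
Proof.
rewrite {1}/chains big_seq.
apply: (big_ind (fun S : 'M_n => (S <= chains B *m A + heads B)%MS)).
- exact: sub0mx.
- by move=> S T hS hT; rewrite addsmx_sub hS.
move=> p pB; apply/chain_subP => -[|j] jm.
  rewrite expr0 mulmx1 (submx_trans _ (addsmxSr _ _)) //.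
  rewrite /heads (perm_big _ (perm_to_rem pB)) big_cons.
  by rewrite (submx_trans _ (addsmxSl _ _)) // genmxE.
rewrite exprSr mulmxA (submx_trans _ (addsmxSl _ _)) // submxMr //.
rewrite /chains (perm_big _ (perm_to_rem pB)) big_cons.
rewrite (submx_trans _ (addsmxSl _ _)) //.
have /chain_subP := submx_refl (chain p.1 p.2); apply; exact: ltnW.
Qed.

Lemma terminates_cons p B :
  terminates (p :: B) = (p.1 *m A ^+ p.2 == 0) && terminates B.
Proof. by []. Qed.

(** A combination z of heads can itself be made the head of a chain: among the
heads that occur in z, replace one with a longest chain.  The chain of z has
the same length, because the other terms die no later.  The induction combines
heads two by two, keeping the sum on the longer of the two chains. *)
Lemma head_basis_change B z : terminates B -> (z <= heads B)%MS ->
  z = 0 \/ exists m B', [/\ terminates ((z, m) :: B'),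
    total ((z, m) :: B') = total B & (chains B <= chains ((z, m) :: B'))%MS].
Proof.
elim: B z => [|[x m] B IH] z.
  by rewrite /heads big_nil submx0 => _ /eqP->; left.
rewrite terminates_cons /heads big_cons /= -/(heads B) => /andP[/eqP x0 tB].
case/sub_addsmxP => -[u1 u2] /= zE.
have /sub_rVP[a aE] : (u1 *m <<x>>%MS <= x)%MS.
  by rewrite (submx_trans (submxMl _ _)) // genmxE.
move: zE; rewrite aE; set z0 := u2 *m _ => zE.
have [] := IH z0 tB (submxMl _ _).
  move=> z00; rewrite z00 addr0 in zE.
  have [a0|a0] := eqVneq a 0; first by left; rewrite zE a0 scale0r.
  (* z is a multiple of x, which takes its place. *)
  right; exists m, B; rewrite terminates_cons tB !chains_cons /= zE.
  rewrite -scalemxAl x0 scaler0 eqxx; split=> //.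
  apply: addsmxS => //.
  have /chain_comb -/(_ m 0%N) : x = a^-1 *: (a *: x) + 0 *: (0 : 'rV[F]_n).
    by rewrite scale0r addr0 scalerA mulVf // scale1r.
  rewrite mul0mx => /(_ erefl) /submx_trans; apply.
  by rewrite addsmx_sub submx_refl /chain big_ord0 sub0mx.
move=> [m0 [B' [+ tot sB]]].
rewrite terminates_cons /= => /andP[/eqP z00 tB'].
have [a0|a0] := eqVneq a 0.
  right; exists m0, ((x, m) :: B'); rewrite zE a0 scale0r add0r.
  rewrite !terminates_cons /= z00 x0 !eqxx tB'; split=> //.
    by move: tot; rewrite /total /=; lia.
  move: sB; rewrite !chains_cons /= => sB.
  by rewrite addsmxA [(chain z0 m0 + _)%MS]addsmxC -addsmxA addsmxS.
(* Both parts of z are nonzero: z replaces whichever has the longer chain. *)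
right; have [mm|mm] := leqP m0 m.
  exists m, ((z0, m0) :: B'); rewrite !terminates_cons /= z00 eqxx tB' andbT.
  rewrite zE mulmxDl -scalemxAl x0 scaler0 add0r.
  rewrite -(subnKC mm) exprD mulmxA z00 mul0mx eqxx subnKC //.
  split=> //; first by move: tot; rewrite /total /=; lia.
  move: sB; rewrite !chains_cons /= => sB.
  rewrite addsmx_sub (submx_trans sB) ?addsmxSr // andbT addsmxA.
  apply: (submx_trans _ (addsmxSl _ _)).
  apply: (@chain_comb _ _ _ a^-1 (- a^-1)) => //.
  by rewrite scalerDr scalerA mulVf // scale1r scaleNr addrK.
exists m0, ((x, m) :: B'); rewrite !terminates_cons /= x0 eqxx tB' andbT.
rewrite zE mulmxDl z00 addr0 -scalemxAl.
rewrite -(subnKC (ltnW mm)) exprD mulmxA x0 mul0mx scaler0 eqxx subnKC ?(ltnW mm) //.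
split=> //; first by move: tot; rewrite /total /=; lia.
move: sB; rewrite !chains_cons /= => sB.
rewrite addsmx_sub; apply/andP; split.
  by rewrite addsmxA (submx_trans _ (addsmxSl _ _)) ?addsmxSr.
apply: submx_trans sB _; rewrite addsmxA.
rewrite addsmx_sub addsmxSr andbT (submx_trans _ (addsmxSl _ _)) //.
apply: (@chain_comb _ _ _ 1 (- a)) => //.
by rewrite scale1r scaleNr addrAC subrr add0r.
Qed.

(** Write wA = uA + z with u in the span and z a combination of heads, and replace
w by w - u, whose image is z.  After a change of heads z starts a chain, which
w - u extends by one on the left; if z = 0, then w - u is a chain by itself. *)
Lemma chains_extend B w : terminates B -> (w *m A <= chains B)%MS ->
  exists B', [/\ terminates B', total B' = (total B).+1,
                 (chains B <= chains B')%MS & (w <= chains B')%MS].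
Proof.
move=> tB /submx_trans/(_ (chains_step B)) /sub_addsmxP[[u1 u2]] /= wE.
pose u := u1 *m chains B; pose w' := w - u.
have w'A : w' *m A = u2 *m heads B by rewrite mulmxBl wE /u mulmxA addrC addKr.
have wS S : (chains B <= S)%MS -> (w' <= S)%MS -> (w <= S)%MS.
  move=> BS w'S; rewrite -(subrK u w) addmx_sub // (submx_trans _ BS) //.
  exact: submxMl.
have [] := @head_basis_change B (w' *m A) tB; first by rewrite w'A submxMl.
  move=> w'0; exists ((w', 1%N) :: B); rewrite terminates_cons tB expr1 w'0 eqxx.
  rewrite chains_cons /=; split=> //; first exact: addsmxSr.
  apply: wS; first exact: addsmxSr.
  rewrite (submx_trans _ (addsmxSl _ _)) // -{1}[w']mulmx1.
  by have /chain_subP/(_ 0%N) := submx_refl (chain w' 1); rewrite expr0; apply.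
move=> [m [B' [+ tot sB]]]; rewrite terminates_cons /= => /andP[/eqP z0 tB'].
have cS : (chains B <= chains ((w', m.+1) :: B'))%MS.
  apply: submx_trans sB _; rewrite !chains_cons /= addsmxS //.
  apply/chain_subP => j jm; rewrite -mulmxA mulmxE -exprS.
  by have /chain_subP := submx_refl (chain w' m.+1); apply.
exists ((w', m.+1) :: B'); rewrite terminates_cons tB' /= exprS -mulmxE mulmxA z0.
rewrite eqxx; split=> //; first by move: tot; rewrite /total /=; lia.
apply: wS => //; rewrite chains_cons (submx_trans _ (addsmxSl _ _)) //=.
have /chain_subP/(_ 0%N) := submx_refl (chain w' m.+1).
by rewrite expr0 mulmx1; apply.
Qed.

(** Strict upper triangularity says that each standard basis vector is mapped into
the span of the later ones, so the basis is exhausted from the last vector. *)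
Lemma strictly_upper_chains : strictly_upper A ->
  exists B, [/\ terminates B, total B = n & (1%:M <= chains B)%MS].
Proof.
move=> /forallP sA.
suff H k : (k <= n)%N -> exists B, [/\ terminates B, total B = k &
    forall i : 'I_n, (n <= i + k)%N -> ((delta_mx 0 i : 'rV_n) <= chains B)%MS].
  have [B [tB tot sB]] := H n (leqnn n); exists B; split=> //.
  by apply/row_subP => i; rewrite row1 sB // leq_addl.
elim: k => [_|k IH kn].
  by exists [::]; split=> // i; have := ltn_ord i; lia.
have [B [tB tot sB]] := IH (ltnW kn).
have i0P : (n - k.+1 < n)%N by lia.
pose i0 := Ordinal i0P; pose w : 'rV[F]_n := delta_mx 0 i0.
have wA : (w *m A <= chains B)%MS.
  rewrite -rowE [row i0 A]row_sum_delta summx_sub // => j _.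
  rewrite mxE; case: (leqP j i0) => ji.
    by have /forallP/(_ j) := sA i0; rewrite ji => /eqP->; rewrite scale0r sub0mx.
  by rewrite scalemx_sub // sB //; move: ji; rewrite /=; lia.
have [B' [tB' tot' cB wB]] := chains_extend tB wA.
exists B'; split=> //; first by rewrite tot' tot.
move=> i; case: (ltnP (i + k)%N n) => h1 h2; last by rewrite (submx_trans (sB _ h1)).
by have -> : i = i0 by apply: val_inj => /=; lia.
Qed.

(** Chains of length 0 span nothing, so that they may be dropped to make the list
of lengths a partition. *)
Lemma chains_sorted B : exists B0, [/\ is_partition (unzip2 B0),
  total B0 = total B, terminates B -> terminates B0 & chains B0 = chains B].
Proof.
pose r := [rel p q : 'rV[F]_n * nat | (q.2 <= p.2)%N].
pose B0 := sort r [seq p <- B | (0 < p.2)%N]; exists B0.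
have pB0 : perm_eq B0 [seq p <- B | (0 < p.2)%N] by rewrite perm_sort.
split.
- apply/andP; split.
    rewrite sorted_map; apply: (@sort_sorted _ r) => p q /=; lia.
  rewrite all_map (perm_all _ pB0); apply/allP => p.
  by rewrite mem_filter => /andP[].
- rewrite /total !sumnE !big_map (perm_big _ pB0) /= big_filter big_mkcond.
  by apply: eq_bigr => p _; case: posnP.
- move=> /allP tB; apply/allP => p; rewrite (perm_mem pB0) mem_filter => /andP[_].
  exact: tB.
rewrite /chains (perm_big _ pB0) /= big_filter big_mkcond; apply: eq_bigr => p _.
by case: posnP => // ->; rewrite /chain big_ord0.
Qed.

(** The rows of W are the chain vectors: multiplying W on the left by a Jordan
block moves each row to the next, as A does on the right. *)
Lemma strictly_upper_jordan : strictly_upper A ->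
  exists lam, [/\ is_partition lam, sumn lam = n &
    exists2 W : 'M[F]_(weight lam, n), jordan_mx F lam *m W = W *m A & row_full W].
Proof.
move=> /strictly_upper_chains[B1 [tB1 tot1 sB1]].
have [B [pB tot tB sB]] := chains_sorted B1.
exists (unzip2 B); split=> //; first exact: etrans tot tot1.
pose x0 : 'rV[F]_n * nat := (0, 0%N).
have lamE i : (i < size B)%N -> nth 0%N (unzip2 B) i = (nth x0 B i).2.
  by move=> iB; rewrite (nth_map x0).
pose C i : 'M[F]_(nth 0%N (unzip2 B) i, n) :=
  \matrix_(j < nth 0%N (unzip2 B) i) ((nth x0 B i).1 *m A ^+ j).
exists (\mxcol_(i < size (unzip2 B)) C i).
  rewrite mxcol_mul /jordan_mx mul_mxdiag_mxcol; apply: eq_mxcol => i.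
  have iB : (i < size B)%N by rewrite -(size_map snd B).
  apply/row_matrixP => j; rewrite !row_mul rowK.
  case: (ltnP j.+1 (nth 0%N (unzip2 B) i)) => jm.
    have -> : row j (jordan_block F (nth 0%N (unzip2 B) i))
        = delta_mx 0 (Ordinal jm).
      by apply/rowP => l; rewrite !mxE eqxx /= eq_sym.
    by rewrite -rowE rowK exprSr mulmxA.
  have -> : row j (jordan_block F (nth 0%N (unzip2 B) i)) = 0.
    apply/rowP => l; rewrite !mxE; case: eqP => // e; have := ltn_ord l; lia.
  have /allP/(_ _ (mem_nth x0 iB)) /eqP := tB tB1.
  have -> : (nth x0 B i).2 = j.+1 by rewrite -lamE //; have := ltn_ord j; lia.
  by rewrite mul0mx exprSr mulmxA => ->.
rewrite -sub1mx (submx_trans sB1) // -sB eqmx_col.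
rewrite /chains (big_nth x0) big_mkord; apply/sumsmx_subP => p _.
apply/chain_subP => j jm.
have ip : (p < size (unzip2 B))%N by rewrite size_map.
rewrite -lamE // in jm.
apply: (sumsmx_sup (Ordinal ip)) => //; rewrite genmxE.
by have := row_sub (Ordinal jm) (C p); rewrite rowK.
Qed.

End Chains.
End Jordan.

(** Ranks of powers are invariant under conjugation.  Conversely the Jordan form
of A has the prescribed ranks, and these determine its partition. *)
Lemma has_jordan_typeP (F : finFieldType) lam (A : 'M[F]_(weight lam)) :
  is_partition lam -> strictly_upper A ->
  has_jordan_type A <-> forall k, \rank (A ^+ k) = pow_rank lam k.
Proof.
move=> pl sA; split=> [/existsP[V /andP[uV /eqP AE]] k|rA].
  apply: (@rank_exp_of_jordan _ _ _ (invmx V)).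
  - by rewrite AE !mulmxA mulVmx // mul1mx.
  - by rewrite row_free_unit unitmx_inv.
  - by rewrite row_full_unit unitmx_inv.
have [mu [pm sm [W JW fW]]] := strictly_upper_jordan sA.
have frW : row_free W.
  by rewrite /row_free; move: fW; rewrite /row_full => /eqP->; rewrite (weightE mu) sm.
have e : mu = lam.
  by apply: pow_rank_inj => // k; rewrite -rA (rank_exp_of_jordan k JW).
rewrite e in W JW fW frW *; apply/existsP; exists (invmx W).
rewrite row_free_unit in frW.
by rewrite unitmx_inv frW invmxK -mulmxA JW mulmxA mulVmx // mul1mx eqxx.
Qed.

(** * Bordering a strictly upper triangular matrix *)

Section Border.
Variables (F : fieldType) (n : nat).
Implicit Types (A : 'M[F]_n) (v : 'rV[F]_n).

Definition border v A : 'M[F]_(1 + n) := block_mx 0 v 0 A.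

Lemma border_exp v A k :
  border v A ^+ k.+1 = block_mx 0 (v *m A ^+ k) 0 (A ^+ k.+1).
Proof.
elim: k => [|k IH]; first by rewrite !expr1 expr0 -idmxE mulmx1.
rewrite exprSr IH -mulmxE mulmx_block !mul0mx !mulmx0 !add0r.
by rewrite -mulmxA !mulmxE -!exprSr.
Qed.

Lemma rank_border_block m (v : 'rV[F]_n) (M : 'M[F]_(m, n)) :
  \rank (block_mx (0 : 'M_(1, 1)) v 0 M) = (\rank M + ~~ (v <= M)%MS)%N.
Proof.
rewrite block_mxEh col_mx0 rank_row_0mx -addsmxE.
case: (boolP (v <= M)%MS) => h.
  by rewrite addn0; apply: eqmx_rank; rewrite addsmxSr addsmx_sub h submx_refl.
apply/eqP; rewrite eqn_leq; apply/andP; split.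
  rewrite (leq_trans (mxrank_adds_leqif _ _)) // addnC leq_add2l.
  exact: rank_leq_row.
rewrite addn1 rank_ltmx // ltmxE addsmxSr /=; apply: contra h.
by move=> h; rewrite (submx_trans _ h) ?addsmxSl.
Qed.

Lemma rank_border_exp v A k : \rank (border v A ^+ k.+1) =
  (\rank (A ^+ k.+1) + ~~ (v *m A ^+ k <= A ^+ k.+1)%MS)%N.
Proof. by rewrite border_exp rank_border_block. Qed.

Lemma strictly_upper_border v A : strictly_upper (border v A) = strictly_upper A.
Proof.
apply/forallP/forallP => h i; apply/forallP => j; apply/implyP => ij.
  have /forallP/(_ (rshift 1 j)) := h (rshift 1 i).
  by rewrite block_mxEdr leq_add2l ij.
case: (split_ordP i) ij => [k|k] ->; case: (split_ordP j) => [l|l] -> ij.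
- by rewrite block_mxEul mxE.
- by move: ij; rewrite /= (ord1 k).
- by rewrite block_mxEdl mxE.
rewrite block_mxEdr; have /forallP/(_ l) := h k.
by move: ij; rewrite /= leq_add2l => ->.
Qed.

Lemma strictly_upperE (M : 'M[F]_(1 + n)) : strictly_upper M ->
  M = border (ursubmx M) (drsubmx M).
Proof.
move=> /forallP h; rewrite -{1}[M]submxK /border; congr block_mx.
  apply/matrixP => i j; rewrite !mxE (ord1 i) (ord1 j).
  by have /forallP/(_ (lshift n 0)) := h (lshift n 0); rewrite leqnn => /eqP.
apply/matrixP => i j; rewrite !mxE (ord1 j).
by have /forallP/(_ (lshift n 0)) := h (rshift 1 i) => /eqP.
Qed.

(** The subspace im A + ker A^k; a first row v makes the bordered matrix gain its
cell in one of the columns 1, ..., k + 1 exactly when v lies in it. *)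
Definition reach A k : 'M[F]_n := (A + kermx (A ^+ k))%MS.

(** If v A^k = u A^(k+1), then v - uA is in the kernel of A^k. *)
Lemma sub_reach A k v : (v <= reach A k)%MS = (v *m A ^+ k <= A ^+ k.+1)%MS.
Proof.
have AE : A ^+ k.+1 = A *m A ^+ k by rewrite exprS.
apply/idP/idP => [h|/submxP[u uE]].
  apply: submx_trans (submxMr _ h) _.
  by rewrite addsmxMr mulmx_ker addsmx0 AE.
rewrite -(subrK (u *m A) v) addrC addmx_sub_adds ?submxMl //.
by apply/sub_kermxP; rewrite mulmxBl uE -mulmxA AE subrr.
Qed.

(** The map A^k sends im A + ker A^k onto im A^(k+1), with kernel ker A^k. *)
Lemma rank_reach A k :
  (\rank (reach A k) + \rank (A ^+ k) = n + \rank (A ^+ k.+1))%N.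
Proof.
have := mxrank_mul_ker (reach A k) (A ^+ k).
rewrite addsmxMr mulmx_ker addsmx0 mulmxE -exprS.
rewrite (capmx_idPr _) ?addsmxSr // mxrank_ker => <-.
by have := rank_leq_row (A ^+ k); lia.
Qed.

Lemma reachS A k : (reach A k <= reach A k.+1)%MS.
Proof.
apply/row_subP => i; have := row_sub i (reach A k); rewrite !sub_reach => h.
by have := submxMr A h; rewrite -mulmxA mulmxE -!exprSr.
Qed.

Lemma reach_mono A k l : (k <= l)%N -> (reach A k <= reach A l)%MS.
Proof.
by move=> /subnKC <-; elim: (l - k)%N => [|m IH]; rewrite ?addn0 // addnS
  (submx_trans IH) // reachS.
Qed.

End Border.

(** Convexity of the ranks of powers: the differences rank A^k - rank A^(k+1) do
not increase, which is what makes them column lengths. *)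
Lemma reach_col_mono (F : fieldType) n (A : 'M[F]_n) k :
  (\rank (A ^+ k.+1) + \rank (A ^+ k.+1) <= \rank (A ^+ k) + \rank (A ^+ k.+2))%N.
Proof.
have := mxrankS (reachS A k); have := rank_reach A k; have := rank_reach A k.+1; lia.
Qed.

Section Count.
Variable F : finFieldType.

Definition has_ranks n (A : 'M[F]_n) lam : bool :=
  `[< forall k, \rank (A ^+ k) = pow_rank lam k >].

Definition count_ranks n lam : nat :=
  #|[set A : 'M[F]_n | strictly_upper A & has_ranks A lam]|.

(** Counting by ranks frees the order of the matrices from the partition, so that
one may induct on it. *)
Lemma num_jordan_typeE lam : is_partition lam ->
  num_jordan_type F lam = count_ranks (sumn lam) lam.
Proof.
move=> pl; rewrite -weightE /num_jordan_type /count_ranks; congr #|pred_of_set _|.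
apply/setP => A; rewrite !inE; case: (boolP (strictly_upper A)) => //= sA.
by apply/idP/asboolP => /has_jordan_typeP; apply.
Qed.

Definition reachable n (A : 'M[F]_n) k : {set 'rV[F]_n} := rowg (reach A k).

Lemma card_reachable n (A : 'M[F]_n) k :
  #|reachable A k| = (#|F| ^ (n + \rank (A ^+ k.+1) - \rank (A ^+ k)))%N.
Proof. by rewrite card_rowg -rank_reach addnK. Qed.

Lemma reachable_mono n (A : 'M[F]_n) k l :
  (k <= l)%N -> reachable A k \subset reachable A l.
Proof.
move=> kl; apply/subsetP => v; rewrite !mem_rowg => /submx_trans; apply.
exact: reach_mono.
Qed.

Lemma has_ranks_border n (A : 'M[F]_n) v lam : sumn lam = n.+1 ->
  reflect (forall k, (\rank (A ^+ k.+1) + (v \notin reachable A k))%N = pow_rank lam k.+1)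
    (has_ranks (border v A) lam).
Proof.
move=> sl; apply: (iffP (asboolP _)) => h k.
  by rewrite mem_rowg sub_reach -h rank_border_exp.
case: k => [|k]; first by rewrite expr0 pow_rank0 sl -idmxE mxrank1.
by rewrite rank_border_exp -h mem_rowg sub_reach.
Qed.

(** The number of first rows that put the new cell at c; the second term is absent
in column 1, where there is no smaller subspace to exclude. *)
Definition num_borders n lam c : nat :=
  let mu := remove_cell lam c in
  (#|F| ^ (n - dual_part mu c.2) - (1 < c.2) * #|F| ^ (n - dual_part mu c.2.-1))%N.

(** The ranks prescribe for which k the row v avoids im A + ker A^k, namely for
k < c - 1.  As these spaces increase, v ranges over the difference of two
consecutive ones. *)
Lemma card_border_col n (A : 'M[F]_n) lam c : is_partition lam -> sumn lam = n.+1 ->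
  c \in removable_cells lam -> has_ranks A (remove_cell lam c) ->
  #|[set v | has_ranks (border v A) lam]| = num_borders n lam c.
Proof.
move=> pl sl rc /asboolP rA; have c0 := removable_col_gt0 pl rc.
have [pm _] := removableP rc.
set mu := remove_cell lam c in rA *.
have cR k : #|reachable A k| = (#|F| ^ (n - dual_part mu k.+1))%N.
  by rewrite card_reachable !rA (pow_rankS mu k); congr (_ ^ _)%N; lia.
have mono := reachable_mono A.
have condE v : has_ranks (border v A) lam =
    `[< forall k, (v \notin reachable A k) = (k.+1 < c.2)%N >].
  apply/(has_ranks_border _ _ sl)/asboolP => h k.
    have := h k; rewrite (pow_rank_remove _ rc pl) -/mu -rA => /addnI.
    by case: (_ \notin _); case: (_ < _)%N.
  by rewrite h (pow_rank_remove _ rc pl) -/mu -rA.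
rewrite /num_borders -/mu; case E : c.2 c0 => [//|[|j]] _ /=.
  rewrite mul0n subn0 -cR; congr #|pred_of_set _|.
  apply/setP => v; rewrite inE condE E; apply/asboolP/idP => [/(_ 0%N)/negbFE //|v0 k].
  by rewrite ltnS ltn0; apply/negbF; apply: (subsetP (mono 0%N k _)).
rewrite mul1n -!cR -(setIidPr (mono _ _ (leqnSn j))) -cardsD.
congr #|pred_of_set _|; apply/setP => v; rewrite in_set in_setD condE E.
apply/asboolP/andP => [h|[vj vj1] k].
  by have := h j; have := h j.+1; rewrite !ltnS ltnn leqnn => /negbFE -> ->.
rewrite !ltnS; case: (leqP k j) => kj.
  by apply: contra vj; apply: (subsetP (mono _ _ kj)).
by apply/negbF; apply: (subsetP (mono _ _ kj)).
Qed.

(** Let j be the first index at which v is reached.  The ranks for A are those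
for lam lowered by 1 up to k = j, so column j + 1 loses a cell; by convexity of
the ranks for A, the next column of lam is strictly shorter, so that the cell
is removable. *)
Lemma has_ranks_removed n (A : 'M[F]_n) v lam : is_partition lam -> sumn lam = n.+1 ->
  has_ranks (border v A) lam ->
  exists2 c, c \in removable_cells lam & has_ranks A (remove_cell lam c).
Proof.
move=> pl sl /(has_ranks_border _ _ sl) h.
have ex : exists k, v \in reachable A k.
  exists n; have := h n; rewrite (@pow_rank_eq0 lam) ?sl //.
  by case: (v \in _); rewrite ?addn1.
have mono := reachable_mono A.
case: (ex_minnP ex) => j vj jmin.
have vE k : (v \notin reachable A k) = (k < j)%N.
  rewrite ltnNge; congr negb; apply/idP/idP; first exact: jmin.
  by move/mono/subsetP; apply.
have rE k : pow_rank lam k = (\rank (A ^+ k) + (k < j.+1))%N.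
  case: k => [|k]; first by rewrite pow_rank0 sl expr0 -idmxE mxrank1 addn1.
  by rewrite -h vE.
have hj : (dual_part lam j.+2 < dual_part lam j.+1)%N.
  have := pow_rankS lam j; have := pow_rankS lam j.+1.
  rewrite !rE ltnn ltnSn [(j.+2 < _)%N]ltnNge (ltnW (ltnSn _)) !addn0.
  have := reach_col_mono A j.
  move: (\rank _) (\rank _) (\rank _) => a b d; lia.
have [c rc cj] := removable_col_exists pl (ltn0Sn j) hj.
exists c => //; apply/asboolP => k.
by have := rE k; rewrite (pow_rank_remove _ rc pl) cj => /addIn.
Qed.

(** The partition of A, hence the removed cell, is unique when it exists. *)
Lemma card_border n (A : 'M[F]_n) lam : is_partition lam -> sumn lam = n.+1 ->
  #|[set v | has_ranks (border v A) lam]| =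
  (\sum_(c <- removable_cells lam)
     has_ranks A (remove_cell lam c) * num_borders n lam c)%N.
Proof.
move=> pl sl.
have [/hasP[c rc hc]|/hasPn hn] :=
    boolP (has (fun c => has_ranks A (remove_cell lam c)) (removable_cells lam)).
  rewrite (card_border_col pl sl rc hc) (bigD1_seq _ rc (uniq_removable lam)) /=.
  rewrite hc mul1n big1_seq ?addn0 // => c' /andP[cc' rc'].
  case hc' : (has_ranks A (remove_cell lam c')) => //; case/eqP: cc'.
  apply: (removable_col_inj rc' rc).
  move/asboolP: hc => hc; move/asboolP: hc' => hc'.
  have colE k : (k < c.2)%N = (k < c'.2)%N.
    have := pow_rank_remove k rc pl; rewrite (pow_rank_remove k rc' pl) -hc -hc'.
    by move/addnI; case: (_ < _)%N; case: (_ < _)%N.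
  by have := colE c.2; have := colE c'.2; rewrite !ltnn; case: ltngtP.
rewrite big1_seq => [|c /hn/negPf-> //].
apply/eqP; rewrite cards_eq0; apply/eqP/setP => v; rewrite !inE.
by apply/negP => /(has_ranks_removed pl sl)[c /hn/negP].
Qed.

(** Sum over the lower right block the number of first rows. *)
Lemma count_ranks_rec n lam : is_partition lam -> sumn lam = n.+1 ->
  count_ranks n.+1 lam =
  (\sum_(c <- removable_cells lam)
     num_borders n lam c * count_ranks n (remove_cell lam c))%N.
Proof.
move=> pl sl.
have -> : count_ranks n.+1 lam = (\sum_(A : 'M[F]_n | strictly_upper A)
    #|[set v | has_ranks (border v A) lam]|)%N.
  pose D := [set p : 'M[F]_n * 'rV[F]_n |
              strictly_upper p.1 & has_ranks (border p.2 p.1) lam].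
  have -> : count_ranks n.+1 lam = #|[set border p.2 p.1 | p in D]|.
    congr #|pred_of_set _|; apply/setP => M; rewrite inE.
    apply/andP/imsetP => [[sM rM]|[[A v]]].
      have ME := strictly_upperE sM.
      exists (drsubmx (M : 'M_(1 + n)), ursubmx (M : 'M_(1 + n))) => //=.
      by rewrite inE /= -ME rM andbT
        -(strictly_upper_border (ursubmx (M : 'M_(1 + n)))) -ME.
    by rewrite inE /= => /andP[sA rA] ->; rewrite strictly_upper_border.
  rewrite card_imset => [|[A v] [A' v'] /= /eq_block_mx[_ -> _ ->] //].
  rewrite -sum1_card.
  under [RHS]eq_bigr do rewrite -sum1_card.
  by rewrite pair_big_dep /=; apply: eq_bigl => -[A v]; rewrite !inE.
rewrite (eq_bigr _ (fun A _ => card_border A pl sl)).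
rewrite exchange_big /=; apply: eq_bigr => c _.
rewrite -big_distrl mulnC /=; congr (_ * _)%N.
by rewrite -big_mkcondr /count_ranks -sum1_card; apply: eq_bigl => A; rewrite inE.
Qed.

Lemma count_ranks_nil : count_ranks 0 [::] = 1%N.
Proof.
rewrite /count_ranks; apply/eqP/cards1P; exists 0; apply/setP => A; rewrite !inE.
rewrite [A]thinmx0 eqxx; apply/andP; split; first by apply/forallP => -[].
apply/asboolP => k; rewrite thinmx0 mxrank0 /pow_rank big_nil //.
Qed.

End Count.

(** * From counts to polynomials *)

Fixpoint R_rec n lam : {poly int} :=
  if n is n'.+1 then
    \sum_(c <- removable_cells lam)
      'X^(dual_part lam c.2.+1) * (\sum_(k < (mult lam c.2.-1).+1) 'X^k)
      * R_rec n' (remove_cell lam c)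
  else 1.

(** All terms are non-negative at x, and that of the last column is positive:
its power of X is X^0, and its geometric sum contains the term 1.  The values
at 0 and 1 are the ones needed. *)
Lemma R_rec_gt0 n lam (x : int) : is_partition lam -> sumn lam = n -> 0 <= x ->
  0 < (R_rec n lam).[x].
Proof.
elim: n lam => [|n IH] lam pl sl x0 /=; first by rewrite hornerC.
have [|c rc cl] := removable_last_col pl; first by rewrite sl.
have RE c' : c' \in removable_cells lam -> 0 < (R_rec n (remove_cell lam c')).[x].
  move=> rc'; have [pm _] := removableP rc'.
  by apply: IH => //; have := sumn_remove rc'; lia.
rewrite horner_sum (bigD1_seq _ rc (uniq_removable lam)) /= ltr_wpDr //.
  rewrite big_seq_cond sumr_ge0 // => c' /andP[rc' _].
  rewrite !hornerM hornerXn mulr_ge0 ?(ltW (RE _ _)) // mulr_ge0 ?exprn_ge0 //.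
  by rewrite horner_sum sumr_ge0 // => k _; rewrite hornerXn exprn_ge0.
rewrite !hornerM mulr_gt0 ?RE // cl hornerXn expr0 mul1r horner_sum.
rewrite big_ord_recl /= hornerXn expr0 ltr_wpDr // sumr_ge0 // => k _.
by rewrite hornerXn exprn_ge0.
Qed.

(** In column c > 1 of lam the difference of powers of q has ratio
q^(alpha_(c-1) + 1), since the columns c - 1 and c of lam differ by alpha_(c-1)
and one more cell is removed from column c; it factors as a geometric sum. *)
Lemma num_bordersE (F : finFieldType) lam (c : nat * nat) : is_partition lam ->
  c \in removable_cells lam ->
  (num_borders F (sumn (remove_cell lam c)) lam c)%:R =
  #|F|%:R ^+ (sumn (remove_cell lam c) - left_col lam c.2)
  * (#|F|%:R - 1) ^+ (1 < c.2)%N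
  * (\sum_(k < (mult lam c.2.-1).+1) 'X^k).[#|F|%:R] :> int.
Proof.
move=> pl rc; have := left_col_bound pl rc.
have := removable_col_gt0 pl rc; have := dual_part_removable pl rc.
rewrite /num_borders /left_col.
case E : c.2 => [//|[|j]] d0 _ /=.
  rewrite mult0_partition // big_ord1 hornerXn expr0 expr0 !mulr1 mul0n subn0 => _.
  by rewrite natrX (dual_part_remove 0 rc) E addn1.
rewrite mul1n expr1; have := mult_dual_part lam j.+1.
have := dual_part_remove j.+1 rc; have := dual_part_remove j rc.
rewrite E eqxx eqSS (gtn_eqF (ltnSn j)) addn0 => <- a1 mE bd.
set a := dual_part lam j.+2 in a1 d0 mE; set b := dual_part lam j.+1 in mE bd *.
set m := mult lam j.+1 in mE *; set N := sumn _ in bd *.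
have -> : (N - dual_part (remove_cell lam c) j.+2 = N - b + m.+1)%N by lia.
rewrite expnD -{2}[(_ ^ (N - b))%N]muln1 -mulnBr natrM natrX -mulrA; congr (_ * _).
rewrite natrB ?expn_gt0 ?(ltnW (card_finNzRing_gt1 F)) // natrX subrX1.
by rewrite horner_sum; congr (_ * _); apply: eq_bigr => k _; rewrite hornerXn.
Qed.

Lemma count_ranksE (F : finFieldType) n lam : is_partition lam -> sumn lam = n ->
  (count_ranks F n lam)%:R =
  ('X^(q_exponent lam) * ('X - 1) ^+ Q_exponent lam * R_rec n lam).[#|F|%:R] :> int.
Proof.
elim: n lam => [|n IH] lam pl sl.
  case: lam pl sl => [|m s]; last first.
    by rewrite is_partition_cons => /and3P[m0 _ _] /=; lia.
  by rewrite count_ranks_nil /q_exponent /Q_exponent /= expr0 expr0 !mulr1 hornerC.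
rewrite (count_ranks_rec _ pl sl) natr_sum /= mulr_sumr horner_sum.
rewrite big_seq [RHS]big_seq; apply: eq_bigr => c rc.
have [pm _] := removableP rc.
have sm : sumn (remove_cell lam c) = n by move: (sumn_remove rc); rewrite sl => -[<-].
rewrite natrM (IH _ pm sm) -{1}sm (num_bordersE _ pl rc) sm.
rewrite !hornerM !horner_exp !hornerD !hornerN !hornerX hornerC.
rewrite (Q_exponent_remove pl rc) exprD.
have := q_exponent_remove pl rc; have := left_col_bound pl rc; rewrite sm => lb qe.
set l := left_col _ _ in lb qe *; set d := dual_part _ _ in lb qe *.
have -> : (n - l = d + (n - l - d))%N by lia.
have -> : (q_exponent lam = q_exponent (remove_cell lam c) +
  (n - l - d))%N by lia.
by rewrite !exprD; ring.
Qed.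

Lemma uniq_primes n : exists s, [/\ uniq s, all prime s & size s = n].
Proof.
elim: n => [|n [s [us ps ss]]]; first by exists [::].
have [p pp pr] := prime_above (\max_(i <- s) i).
exists (p :: s); rewrite /= us ps pr ss; split=> //; rewrite andbT.
by apply/negP => ps'; move: pp; rewrite ltnNge (leq_bigmax_seq _ ps').
Qed.

(** Prime fields already give infinitely many values of q. *)
Lemma poly_eq_fields (p p' : {poly int}) :
  (forall F : finFieldType, p.[#|F|%:R] = p'.[#|F|%:R]) -> p = p'.
Proof.
move=> h; apply/eqP; rewrite -subr_eq0; apply/negP => /negP d0.
have [s [us /allP ps ss]] := uniq_primes (size (p - p')).
suff : (size [seq k%:R : int | k <- s] < size (p - p')%R)%N by rewrite size_map ss ltnn.
apply: max_poly_roots d0 _ _; last first.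
  by rewrite map_inj_uniq // => a b /eqP; rewrite eqr_nat => /eqP.
apply/allP => _ /mapP[k /ps kp ->]; rewrite rootE hornerD hornerN.
by have := h 'F_k; rewrite card_Fp // => ->; rewrite subrr.
Qed.

Lemma P_polyE lam : is_partition lam ->
  P_poly lam = 'X^(q_exponent lam) * ('X - 1) ^+ Q_exponent lam * R_rec (sumn lam) lam.
Proof.
move=> pl; apply: xget_subset1 => [F|p p' hp hp'].
  by rewrite num_jordan_typeE // (count_ranksE _ pl).
by apply: poly_eq_fields => F; rewrite hp hp'.
Qed.

(** Compare the exponents by evaluation at 0, then at 1, after cancelling the
smaller power. *)
Lemma cofactor_unique d e d' e' (r r' : {poly int}) :
  'X^d * ('X - 1) ^+ e * r = 'X^d' * ('X - 1) ^+ e' * r' ->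
  r.[0] != 0 -> r.[1] != 0 -> r'.[0] != 0 -> r'.[1] != 0 -> r = r'.
Proof.
wlog dd : d e d' e' r r' / (d <= d')%N.
  move=> H h *; case: (leqP d d') => [dd|/ltnW dd]; first exact: (H _ _ _ _ _ _ dd h).
  by symmetry; apply: (H _ _ _ _ _ _ dd (esym h)).
move=> h r0 r1 r0' r1'.
have X1 : 'X - 1 != 0 :> {poly int} by rewrite -size_poly_eq0 size_XsubC.
have {}h : ('X - 1) ^+ e * r = 'X^(d' - d) * ('X - 1) ^+ e' * r'.
  apply: (mulfI (_ : 'X^d != 0)); first by rewrite expf_neq0 ?polyX_eq0.
  by rewrite mulrA h -{1}(subnKC dd) exprD !mulrA.
have d0 : (d' - d = 0)%N.
  apply/eqP; move/(congr1 (horner^~ 0)): h; rewrite !hornerM !horner_exp !hornerE.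
  case: (_ - _)%N => // m; rewrite exprS !mul0r => /eqP.
  by rewrite mulf_eq0 (negPf r0) orbF expf_eq0 andbC.
move: h; rewrite d0 expr0 mul1r.
wlog ee : e e' r r' r0 r1 r0' r1' / (e <= e')%N.
  move=> H h; case: (leqP e e') => [ee|/ltnW ee]; first exact: (H e e').
  by symmetry; apply: (H e' e).
rewrite -(subnKC ee) exprD -mulrA => /(mulfI (expf_neq0 _ X1)) h.
have e0 : (e' - e = 0)%N.
  apply/eqP; move/(congr1 (horner^~ 1)): h; rewrite !hornerM !horner_exp !hornerE.
  by case: (_ - _)%N => // m; rewrite subrr exprS !mul0r => /eqP; rewrite (negPf r1).
by rewrite h e0 expr0 mul1r.
Qed.

Lemma R_polyE lam : is_partition lam -> R_poly lam = R_rec (sumn lam) lam.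
Proof.
move=> pl.
have R0 : (R_rec (sumn lam) lam).[0] != 0 by rewrite gt_eqF // R_rec_gt0.
have R1 : (R_rec (sumn lam) lam).[1] != 0 by rewrite gt_eqF // R_rec_gt0.
apply: xget_subset1.
  by exists (q_exponent lam), (Q_exponent lam); rewrite P_polyE.
move=> r r' [d [e [h r0 r1]]] [d' [e' [h' r0' r1']]].
by apply: (@cofactor_unique d e d' e'); rewrite -?h -?h'.
Qed.

Theorem theorem5p2 (n : nat) (lam : seq nat) :
  (0 < n)%N -> is_partition_of n lam ->
  R_poly lam =
    \sum_(c <- removable_cells lam)
      'X^(dual_part lam c.2.+1) * (\sum_(k < (mult lam c.2.-1).+1) 'X^k)
      * R_poly (remove_cell lam c)
  /\
  tofrac (R_poly lam) =
    \sum_(c <- removable_cells lam)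
      tofrac ('X^(dual_part lam c.2.+1) * (1 - 'X^((mult lam c.2.-1).+1)))
      / tofrac (1 - 'X)
      * tofrac (R_poly (remove_cell lam c))
  :> {fraction {poly int}}.
Proof.
move=> n0 /andP[pl /eqP sl].
have RE : R_poly lam = \sum_(c <- removable_cells lam)
      'X^(dual_part lam c.2.+1) * (\sum_(k < (mult lam c.2.-1).+1) 'X^k)
      * R_poly (remove_cell lam c).
  rewrite R_polyE // sl; case: n n0 sl => // n _ sl /=.
  rewrite big_seq [RHS]big_seq; apply: eq_bigr => c rc.
  have [pm _] := removableP rc.
  by rewrite R_polyE //; have := sumn_remove rc; rewrite sl => -[<-].
split=> //; rewrite RE rmorph_sum /=; apply: eq_bigr => c _.
have X1 : 1 - 'X != 0 :> {poly int}.
  by rewrite -oppr_eq0 opprB -size_poly_eq0 size_XsubC.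
rewrite rmorphM; congr (_ * _).
apply: (mulIf (_ : tofrac (1 - 'X : {poly int}) != 0)); first by rewrite tofrac_eq0.
rewrite divfK ?tofrac_eq0 // -rmorphM -mulrA; congr (tofrac (_ * _)).
by rewrite -opprB mulrN mulrC -subrX1 opprB.
Qed.
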